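(* For every positive integer $k$ and every large $n$, there is a set $E$ of $n$ points in $\mathbb{R}^6$ such that the number of tuples $(x_1,\dots,x_{k+2})$ with $x_1=0$ (the origin), $x_2,\dots,x_{k+2}\in E$, and $\angle(x_j,x_{j+1},x_{j+2})=\pi/2$ for all $1\le j\le k$, is $\approx n^{k+1}$.
   Context: $\angle(x,y,z)\in[0,\pi]$ denotes the angle at $y$ between $x-y$ and $z-y$ (for $x\ne y\ne z$). $X\approx Y$ means $cY\le X\le CY$ for all $n>N$ with positive constants $c,C,N$ independent of $n$ (possibly depending on $k$). *)

(* Defs.v *)
From mathcomp Require Import all_boot all_order all_algebra.
From mathcomp Require Import all_classical all_reals all_analysis.
Set Implicit Arguments.
Unset Strict Implicit.
Unset Printing Implicit Defensive.
Import Order.TTheory GRing.Theory Num.Theory.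
Local Open Scope classical_set_scope.
Local Open Scope ring_scope.

Definition dotp (R : realType) (d : nat) (u v : 'rV[R]_d) : R :=
  \sum_(i < d) u ord0 i * v ord0 i.

(* The norm `|u| that MathComp-Analysis puts on 'rV[R]_d is the sup norm, hence
   this separate Euclidean norm. *)
Definition enorm (R : realType) (d : nat) (u : 'rV[R]_d) : R :=
  Num.sqrt (dotp u u).

(* Only meaningful when x != y and y != z: otherwise the quotient is 0 and the
   value is the junk acos 0 = pi / 2. *)
Definition angle (R : realType) (d : nat) (x y z : 'rV[R]_d) : R :=
  acos (dotp (x - y) (z - y) / (enorm (x - y) * enorm (z - y))).

(* The tuple is indexed from 0, so x`_0 is the first point of the chain.  The
   inequations express that each angle is defined. *)
Definition right_angle_chains (R : realType) (d k : nat) (E : set 'rV[R]_d) :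
    set (k.+2.-tuple 'rV[R]_d) :=
  [set x | [/\ x`_0 = 0,
      forall j, (0 < j < k.+2)%N -> E x`_j &
      forall j, (j < k)%N ->
        [/\ x`_j != x`_j.+1, x`_j.+1 != x`_j.+2 &
            angle x`_j x`_j.+1 x`_j.+2 = pi / 2]]].

Arguments right_angle_chains {R d} k E _.

(* Main.v *)
(* Write R^6 as an orthogonal sum of three planes P_0, P_1, P_2, with index
   taken mod 3, fix a unit vector e_i in each P_i, and put
   q_a = e_0 + ... + e_(a-1).  Let A_a be the circle in q_a + P_a with diameter
   [q_a, q_(a+1)].  If x is in A_(a-1), y in A_a and z in A_(a+1), then x - q_a
   is in P_(a-1) and z - q_(a+1) is in P_(a+1), so that
     (x - y) . (z - y) = (q_a - y) . (q_(a+1) - y) = 0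
   by Thales' theorem; the same holds with x = 0 = q_0 when a = 0.  Spreading n
   points evenly over A_0, ..., A_k makes every tuple of A_0 x ... x A_k yield a
   chain, hence at least floor(n / (k+1))^(k+1) chains; n^(k+1) is an obvious
   upper bound. *)
Require Import Defs.
From mathcomp Require Import all_boot all_order all_algebra.
From mathcomp Require Import all_classical all_reals all_analysis.
From mathcomp Require Import zify ring lra.
Import Order.TTheory GRing.Theory Num.Theory.
Local Open Scope classical_set_scope.
Local Open Scope card_scope.
Local Open Scope ring_scope.

Section DotProduct.
Context {R : realType} {d : nat}.
Implicit Types u v w x y z : 'rV[R]_d.

Lemma dotpC u v : dotp u v = dotp v u.
Proof. by apply: eq_bigr => i _; rewrite mulrC. Qed.

Lemma dotpDl u v w : dotp (u + v) w = dotp u w + dotp v w.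
Proof. by rewrite -big_split; apply: eq_bigr => i _; rewrite mxE mulrDl. Qed.

Lemma dotpNl u w : dotp (- u) w = - dotp u w.
Proof. by rewrite -sumrN; apply: eq_bigr => i _; rewrite mxE mulNr. Qed.

Lemma dotpDr u v w : dotp u (v + w) = dotp u v + dotp u w.
Proof. by rewrite dotpC dotpDl !(dotpC u). Qed.

Lemma dotp0l w : dotp 0 w = 0.
Proof. by apply: big1 => i _; rewrite mxE mul0r. Qed.

Lemma angle_perp x y z : dotp (x - y) (z - y) = 0 -> angle x y z = pi / 2.
Proof. by rewrite /angle => ->; rewrite mul0r acos0. Qed.

End DotProduct.

Section Counting.
Context {R : realType} {d : nat}.
Context {k n : nat} (g : nat -> 'rV[R]_d).

Definition chain_of (f : {ffun 'I_k.+1 -> 'I_n}) : k.+2.-tuple 'rV[R]_d :=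
  [tuple of 0 :: mktuple (fun i => g (f i))].

Lemma nth_chain_of f j : (j < k.+1)%N ->
  (chain_of f)`_j.+1 = g (f (inord j)).
Proof.
move=> jk; rewrite -(inordK jk) inord_val.
by rewrite -(nth_mktuple (fun i => g (f i)) 0).
Qed.

Lemma chain_of_inj : injective g -> injective chain_of.
Proof.
move=> g_inj f1 f2 f12; apply/ffunP => i; apply/val_inj/g_inj.
by rewrite -(inord_val i) -!nth_chain_of ?f12.
Qed.

Lemma card_imset_finset (T : finType) (U : Type) (A : {set T}) (F : T -> U) :
  injective F -> F @` [set` A] #= `I_#|A|.
Proof.
move=> F_inj.
have -> : F @` [set` A] =
    (fun i : 'I_#|A| => F (enum_val i)) @` [set: 'I_#|A|].
  apply/seteqP; split=> _ [x /= xA <-]; last by exists (enum_val x) => //=; apply: enum_valP.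
  by exists (enum_rank_in xA x) => //; rewrite enum_rankK_in.
apply: (card_eq_trans _ (card_esym card_II)).
by apply: inj_card_eq => i j _ _ /F_inj /enum_val_inj.
Qed.

(** Coding a chain by the indices of its points after the origin moves the count into a finite
    type. *)
Definition chain_indices : {set {ffun 'I_k.+1 -> 'I_n}} :=
  [set f | `[< right_angle_chains k (g @` `I_n) (chain_of f) >]].

Lemma card_right_angle_chains : injective g ->
  right_angle_chains k (g @` `I_n) #= `I_#|chain_indices|.
Proof.
move=> g_inj.
have -> : right_angle_chains k (g @` `I_n) = chain_of @` [set` chain_indices].
  apply/seteqP; split=> [x Hx|_ [f /= + <-]]; last by rewrite inE => /asboolP.
  have [x0 xE _] := Hx.
  have /choice [h hP] (i : 'I_k.+1) : exists m : 'I_n, g m = x`_i.+1.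
    by have [m /= mn <-] := xE i.+1 (ltn_ord i); exists (Ordinal mn).
  have xf : chain_of (finfun h) = x.
    apply: eq_from_tnth => i; rewrite !(tnth_nth 0).
    case: i => [[|i] /= ik]; first by rewrite x0.
    rewrite -[nth _ _ _]/((chain_of (finfun h))`_i.+1).
    by rewrite nth_chain_of // ffunE hP inordK.
  by exists (finfun h) => //=; rewrite inE; apply/asboolP; rewrite xf.
exact/card_imset_finset/chain_of_inj.
Qed.

End Counting.

Section Construction.
Context {R : realType}.
Implicit Types (x y t : R) (a b : nat).

(* P_i is spanned by the coordinate vectors of index i and i + 3. *)
Definition planev a x y : 'rV[R]_6 :=
  \row_(i < 6) (if i == (a %% 3)%N :> nat then x
                else if i == (a %% 3 + 3)%N :> nat then y else 0).

Lemma dotp_planev a x y x' y' :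
  dotp (planev a x y) (planev a x' y') = x * x' + y * y'.
Proof.
rewrite /dotp !big_ord_recl big_ord0 !mxE /=.
have := ltn_pmod a (isT : 0 < 3)%N.
by case: (a %% 3)%N => [|[|[|]]] //= _; rewrite /bump /=; ring.
Qed.

Lemma dotp_planev_neq a b x y x' y' : (a %% 3 != b %% 3)%N ->
  dotp (planev a x y) (planev b x' y') = 0.
Proof.
rewrite /dotp !big_ord_recl big_ord0 !mxE /=.
have := ltn_pmod a (isT : 0 < 3)%N; have := ltn_pmod b (isT : 0 < 3)%N.
case: (a %% 3)%N => [|[|[|]]] //=; case: (b %% 3)%N => [|[|[|]]] //= _ _ _;
  rewrite /bump /=; ring.
Qed.

Lemma planevB a x y x' y' :
  planev a x y - planev a x' y' = planev a (x - x') (y - y').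
Proof. by apply/rowP => i; rewrite !mxE; do 2?case: ifP => _ //; rewrite subr0. Qed.

(** This functional kills every e_i, hence every [base a], so it reads off the parameter of a point
    whichever circle the point lies on. *)
Definition height (u : 'rV[R]_6) : R := dotp u (\row_i (2 < i)%N%:R).

Lemma height_planev a x y : height (planev a x y) = y.
Proof.
rewrite /height /dotp !big_ord_recl big_ord0 !mxE /=.
have := ltn_pmod a (isT : 0 < 3)%N.
by case: (a %% 3)%N => [|[|[|]]] //= _; rewrite /bump /=; ring.
Qed.

(** This is q_a, with e_b realised as [planev b 1 0]. *)
Definition base a : 'rV[R]_6 := \sum_(b < a) planev b 1 0.

Lemma baseS a : base a.+1 = base a + planev a 1 0.
Proof. exact: big_ord_recr. Qed.

Lemma height_base a : height (base a) = 0.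
Proof.
elim: a => [|a IHa]; first by rewrite /base big_ord0 /height dotp0l.
by rewrite baseS /height dotpDl -!/(height _) IHa height_planev addr0.
Qed.

(* The circle A_a, without [base a], in its rational parametrization; in P_a the
   coordinates (1, t) / (1 + t^2) solve u . u = u . e_a. *)
Definition circle a t : 'rV[R]_6 :=
  base a + planev a (1 + t ^+ 2)^-1 (t / (1 + t ^+ 2)).

Lemma height_circle a t : height (circle a t) = t / (1 + t ^+ 2).
Proof. by rewrite /height dotpDl -!/(height _) height_base height_planev add0r. Qed.

Lemma denom_neq0 t : 1 + t ^+ 2 != 0.
Proof. by apply: lt0r_neq0; have := sqr_ge0 t; lra. Qed.

(** Orthogonality of [x - base a] to P_a and P_(a+1) covers both the origin and a point of the
    previous circle. All cross terms then vanish, leaving beta^2 - alpha (1 - alpha), which is 0 on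
    the circle. *)
Lemma circle_perp {x : 'rV[R]_6} {a} t t' :
  (forall p q, dotp (x - base a) (planev a p q) = 0) ->
  (forall p q, dotp (x - base a) (planev a.+1 p q) = 0) ->
  dotp (x - circle a t) (circle a.+1 t' - circle a t) = 0.
Proof.
move=> xa xa1; rewrite /circle baseS.
set alpha := (1 + t ^+ 2)^-1; set beta := t / _.
have -> : x - (base a + planev a alpha beta)
    = (x - base a) - planev a alpha beta by rewrite opprD addrA.
have -> : base a + planev a 1 0 + planev a.+1 (1 + t' ^+ 2)^-1 (t' / (1 + t' ^+ 2))
      - (base a + planev a alpha beta)
    = planev a (1 - alpha) (0 - beta)
      + planev a.+1 (1 + t' ^+ 2)^-1 (t' / (1 + t' ^+ 2)).
  rewrite -planevB; move: (planev a.+1 _ _) => v.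
  by rewrite -(addrA (base a)) opprD addrACA subrr add0r addrAC.
rewrite dotpDl !dotpDr xa xa1 !dotpNl dotp_planev dotp_planev_neq.
  by rewrite /alpha /beta; field; exact: denom_neq0.
lia.
Qed.

Lemma circle_perp_base0 t t' :
  dotp (0 - circle 0 t) (circle 1 t' - circle 0 t) = 0.
Proof.
by apply: circle_perp => p q; rewrite /base big_ord0 subrr dotp0l.
Qed.

(** Seen from q_(a+1), a point of A_a is a vector of P_a, and a, a+1, a+2 are distinct mod 3. *)
Lemma circle_perp_circle a t0 t t' :
  dotp (circle a t0 - circle a.+1 t) (circle a.+2 t' - circle a.+1 t) = 0.
Proof.
have -> := @circle_perp (circle a t0) a.+1 t t' => // p q;
  rewrite /circle baseS opprD addrACA addrA subrr add0r planevB;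
  by rewrite dotp_planev_neq //; lia.
Qed.

(* The shift by 2 keeps the parameters in the range t > 1, where the height
   t / (1 + t^2) is injective; this separates points across circles as well. *)
Definition point (K i : nat) : 'rV[R]_6 := circle (i %% K)%N i.+2%:R.

Lemma height_point K i : 0 < height (point K i).
Proof.
by rewrite height_circle divr_gt0 ?ltr0n.
Qed.

Lemma point_inj K : injective (point K).
Proof.
move=> i j /(congr1 height) /eqP; rewrite !height_circle.
rewrite eqr_div ?denom_neq0 // -subr_eq0.
have -> : i.+2%:R * (1 + j.+2%:R ^+ 2) - j.+2%:R * (1 + i.+2%:R ^+ 2)
   = (j.+2%:R - i.+2%:R) * (i.+2%:R * j.+2%:R - 1) :> R by ring.
rewrite mulf_eq0 !subr_eq0 -natrM eqr_nat pnatr_eq1 muln_eq1 orbF.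
by move=> /eqP [].
Qed.

Lemma point_neq0 K i : point K i != 0.
Proof.
apply/eqP => p0; have := height_point K i.
by rewrite p0 /height dotp0l ltxx.
Qed.

(** The congruence puts the point of index [f i] on the circle A_i. *)
Lemma chain_of_point k n (f : {ffun 'I_k.+1 -> 'I_n}) :
  (forall i, f i %% k.+1 = i)%N ->
  right_angle_chains k (point k.+1 @` `I_n) (chain_of (point k.+1) f).
Proof.
move=> fP; set x := chain_of _ f.
have xS i : (i < k.+1)%N -> x`_i.+1 = circle i (f (inord i)).+2%:R.
  by move=> ik; rewrite nth_chain_of // /point fP inordK.
have x_neq i : (i < k.+1)%N -> x`_i != x`_i.+1.
  case: i => [|i] ik; first by rewrite nth_chain_of // eq_sym point_neq0.
  rewrite !nth_chain_of //; last exact: ltnW.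
  (* Equal points would have equal indices, but these have residues i and i+1 mod k+1. *)
  rewrite (inj_eq (@point_inj _)); apply/eqP => fE.
  have := fP (inord i); rewrite fE fP !inordK //; [lia|exact: ltnW].
split=> // [[//|j] jk|j jk].
  by rewrite nth_chain_of //; exists (f (inord j)) => /=.
split; [by apply: x_neq; lia|exact: x_neq|apply: angle_perp].
case: j jk => [|j] jk; rewrite !xS; try lia.
  exact: circle_perp_base0.
exact: circle_perp_circle.
Qed.

Lemma leq_card_chain_indices k n :
  ((n %/ k.+1) ^ k.+1 <= #|@chain_indices R 6 k n (point k.+1)|)%N.
Proof.
set m := (n %/ k.+1)%N.
have ltn_idx (a : 'I_m) (i : 'I_k.+1) : (a * k.+1 + i < n)%N.
  have := leq_trunc_div n k.+1; rewrite -/m; have := ltn_ord a.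
  rewrite -(leq_pmul2r (ltn0Sn k)); have := ltn_ord i; lia.
(* Each residue class mod k+1 has at least [m] indices below [n]; [h] chooses one in every class
   independently. *)
pose F (h : {ffun 'I_k.+1 -> 'I_m}) : {ffun 'I_k.+1 -> 'I_n} :=
  [ffun i => Ordinal (ltn_idx (h i) i)].
have F_inj : injective F.
  move=> h1 h2 /ffunP h12; apply/ffunP => i; apply/val_inj.
  have /(congr1 val) := h12 i; rewrite !ffunE /= => /eqP.
  by rewrite eqn_add2r eqn_pmul2r // => /eqP.
have <- : #|[set F h | h in [set: {ffun 'I_k.+1 -> 'I_m}]]%SET| = (m ^ k.+1)%N.
  by rewrite card_imset // cardsT card_ffun !card_ord.
apply/subset_leq_card/fintype.subsetP => _ /imsetP [h _ ->]; rewrite inE.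
apply/asboolP/chain_of_point => i.
by rewrite ffunE /= modnMDl modn_small.
Qed.

End Construction.

Theorem theorem6p2 (R : realType) (k : nat) (hk : (0 < k)%N) :
  exists (c C : R) (N : nat), [/\ 0 < c, 0 < C, (0 < N)%N &
    forall n : nat, (N < n)%N ->
      exists E : set 'rV[R]_6, E #= `I_n /\
        exists m : nat, right_angle_chains k E #= `I_m /\
          c * n%:R ^+ k.+1 <= m%:R <= C * n%:R ^+ k.+1].
Proof.
(* For n > k+1 the quotient q = floor(n / (k+1)) is at least 1, so the remainder is at most q (k+1)
   and n <= 2 (k+1) q. The upper constant 1 counts all index functions. *)
exists ((2 * k.+1)%:R ^- k.+1), 1, k.+1; split=> //.
move=> n kn; have g_inj := @point_inj R k.+1.
exists (point k.+1 @` `I_n); split.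
  by apply: inj_card_eq => i j _ _ /g_inj.
exists #|@chain_indices R 6 k n (point k.+1)|.
split; first exact: card_right_angle_chains.
rewrite mul1r -!natrX ler_nat; apply/andP; split; last first.
  by apply: leq_trans (max_card _) _; rewrite card_ffun !card_ord.
rewrite mulrC ler_pdivrMr ?ltr0n ?expn_gt0 // -natrM ler_nat.
apply: leq_trans _ (leq_mul (leq_card_chain_indices k n) (leqnn _)).
rewrite -expnMn leq_exp2r //.
rewrite {1}(divn_eq n k.+1) mulnCA mul2n -addnn leq_add2l.
have q_gt0 : (0 < n %/ k.+1)%N by rewrite divn_gt0 // ltnW.
exact: leq_trans (ltnW (ltn_pmod n (ltn0Sn k))) (leq_pmull _ q_gt0).
Qed.
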